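(* Let $e\ge 2$ be fixed. For $n\ge 2$ let $c_{n,2e}=-\min_{x\in[-1,1]}Q_{n,2e}(x)$ and $b_{n,2e}=1+Q_{n,2e}(1)/c_{n,2e}$. Then there exist positive constants $A_{2e}$ and $B_{2e}$, depending only on $e$, such that \[\lim_{n\to\infty}\frac{c_{n,2e}}{n^e}=A_{2e}\quad\text{and}\quad\lim_{n\to\infty}\frac{b_{n,2e}}{n^e}=B_{2e}.\] Consequently $c_{n,2e}=A_{2e}n^e(1+o(1))$ and $b_{n,2e}=B_{2e}n^e(1+o(1))$ as $n\to\infty$.
   Context: $Q_{n,k}(x)$ denotes the Gegenbauer polynomial of degree $k$ associated with $\mathbb{S}^{n-1}\subseteq\mathbb{R}^n$: the $Q_{n,k}$ are orthogonal on $[-1,1]$ with respect to the weight $(1-x^2)^{(n-3)/2}$ and normalized so that $Q_{n,k}(1)=\binom{n+k-1}{n-1}-\binom{n+k-3}{n-1}$, the dimension of the space of real homogeneous harmonic polynomials of degree $k$ in $n$ variables. *)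

(* Defs.v *)
From HB Require Import structures.
From mathcomp Require Import all_boot all_order all_algebra.
From mathcomp Require Import all_classical all_reals all_analysis.
Set Implicit Arguments. Unset Strict Implicit. Unset Printing Implicit Defensive.
Import Order.TTheory GRing.Theory Num.Theory.
Import numFieldNormedType.Exports.
Local Open Scope classical_set_scope.
Local Open Scope ring_scope.

(* dim of the space of real homogeneous harmonic polynomials of degree k in n
   variables: binom(n+k-1,n-1) - binom(n+k-3,n-1)  (for n >= 2). *)
Definition harm_dim (n k : nat) : nat :=
  ('C(n + k - 1, n - 1) - 'C(n + k - 3, n - 1))%N.

Definition is_gegenbauer (R : realType) (Q : nat -> nat -> {poly R}) : Prop :=
  forall n : nat, (2 <= n)%N ->
    (forall k : nat, size (Q n k) = k.+1) /\
    (forall j k : nat, j <> k ->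
       (\int[@lebesgue_measure R]_(x in `[(-1)%R, 1%R])
          ((Q n j).[x] * (Q n k).[x] * (1 - x ^+ 2) `^ ((n%:R - 3) / 2))%:E
        = 0)%E) /\
    (forall k : nat, (Q n k).[1] = (harm_dim n k)%:R).

Definition c_coef (R : realType) (Q : nat -> nat -> {poly R}) (n e : nat) : R :=
  - inf [set (Q n (2 * e)%N).[x] | x in `[-1, 1]].

Definition b_coef (R : realType) (Q : nat -> nat -> {poly R}) (n e : nat) : R :=
  1 + (Q n (2 * e)%N).[1] / c_coef Q n e.

(* Main.v *)
Require Import Defs.
From HB Require Import structures.
From mathcomp Require Import all_boot all_order all_algebra.
From mathcomp Require Import all_classical all_reals all_analysis.
From mathcomp Require Import ring lra zify.
Set Implicit Arguments. Unset Strict Implicit. Unset Printing Implicit Defensive.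
Import Order.TTheory GRing.Theory Num.Theory.
Import numFieldNormedType.Exports.
Local Open Scope classical_set_scope.
Local Open Scope ring_scope.

(** Let [q = Q n (2 e)].  The operator [(1 - x^2) p'' - (n - 1) x p'] preserves
    degrees and is self-adjoint for the weight [(1 - x^2)^((n - 3) / 2)], so
    orthogonality makes [q] one of its eigenvectors.  This yields a two-term
    recurrence for the coefficients of [q], which is therefore even, and the
    value at [1] fixes the leading coefficient.  Writing [z = n x^2], the
    polynomial [n^(-e) q(x)] in [z] converges coefficientwise to
    [H(z) = He_(2e)(sqrt z) / (2 e)!] with [He] the Hermite polynomials.  As [H]
    has a positive leading coefficient, the minima over [0 <= z <= n] converge to
    the minimum of [H] over [z >= 0], which is negative by the Hermite equation. *)

(** * Integrals against the weight [(1 - x^2)^a] on [[-1, 1]] *)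

Section weighted_integral.
Variable R : realType.
Implicit Types (a b x : R) (p q r : {poly R}).

(** The limit of a real power at [0] is taken from the right, hence the requirement that [f] be
    eventually positive. *)
Lemma cvg_powR0 (T : Type) (F : set_system T) (FF : Filter F) (f : T -> R) b :
  0 < b -> (\forall t \near F, 0 < f t) -> f @ F --> (0 : R) ->
  f t `^ b @[t --> F] --> (0 : R).
Proof.
move=> b0 f0 cf; have /cvgrPdist_lt pw := powR_cvg0 b0.
apply/cvgrPdist_lt => eps e0; have := pw _ e0.
rewrite /at_right /= near_withinE => /cf.
by apply: filterS2 f0 => t ft0; exact.
Qed.

(** Starting from exponent [b + 1] leaves a polynomial times the weight of exponent [b]. On the open
    interval the base [1 - x^2] is positive, so the power rule applies. *)
Lemma is_derive_poly_weight p b x : -1 < x < 1 ->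
  is_derive x 1 (fun x => p.[x] * (1 - x ^+ 2) `^ (b + 1))
    ((((1 - 'X^2) * p^`() - (2 * b + 2) *: ('X * p)).[x]) * (1 - x ^+ 2) `^ b).
Proof.
move=> /andP[x1 x2]; have u0 : 0 < 1 - x ^+ 2 by nra.
have d2 : is_derive x (1 : R) (fun x => 1 - x ^+ 2) (- (2 * x)).
  have -> : (fun x : R => 1 - x ^+ 2) = horner (1 - 'X^2).
    by apply/funext => y; rewrite !hornerE.
  apply: is_derive_eq; rewrite derivB derivXn derivC !hornerE /=; ring.
have d3 : is_derive x (1 : R) (fun x => (1 - x ^+ 2) `^ (b + 1))
    (- (2 * x) * ((b + 1) * (1 - x ^+ 2) `^ b)).
  have -> : - (2 * x) * ((b + 1) * (1 - x ^+ 2) `^ b) =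
      (b + 1) * (1 - x ^+ 2) `^ (b + 1 - 1) * (- (2 * x)).
    by rewrite addrK; ring.
  have := @is_derive1_comp R (fun y => y `^ (b + 1)) (fun x => 1 - x ^+ 2) x _ _
    (is_derive1_powR _ u0) d2; exact.
apply: is_derive_eq; rewrite !hornerE /= /GRing.scale /=.
rewrite powRD; last by rewrite (gt_eqF u0) implybT.
rewrite powRr1 ?ltW//; ring.
Qed.

Lemma weight_LRcontinuous p b : 0 < b ->
  derivable_oo_LRcontinuous (fun x => p.[x] * (1 - x ^+ 2) `^ b) (-1) 1.
Proof.
move=> b0; split.
- move=> x; rewrite in_itv /= => xI.
  by have [] := is_derive_poly_weight p (b - 1) xI; rewrite subrK.
- rewrite sqrrN expr1n subrr powR0 ?gt_eqF//.
  apply: cvgM; first exact/cvg_at_right_filter/continuous_horner.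
  apply: cvg_powR0 => //.
    by near=> x; rewrite [ltRHS](_ : _ = (x - -1) * (1 - x)); [rewrite mulr_gt0 ?subr_gt0|ring].
  have -> : (fun x : R => 1 - x ^+ 2) = horner (1 - 'X^2).
    by apply/funext => y; rewrite !hornerE.
  rewrite [X in _ --> X](_ : _ = (1 - 'X^2).[-1 : R]).
    exact/cvg_at_right_filter/continuous_horner.
  by rewrite !hornerE /=; ring.
- rewrite expr1n subrr powR0 ?gt_eqF//.
  apply: cvgM; first exact/cvg_at_left_filter/continuous_horner.
  apply: cvg_powR0 => //.
    by near=> x; rewrite [ltRHS](_ : _ = (x - -1) * (1 - x)); [rewrite mulr_gt0 ?subr_gt0|ring].
  have -> : (fun x : R => 1 - x ^+ 2) = horner (1 - 'X^2).
    by apply/funext => y; rewrite !hornerE.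
  rewrite [X in _ --> X](_ : _ = (1 - 'X^2).[1 : R]).
    exact/cvg_at_left_filter/continuous_horner.
  by rewrite !hornerE /=; ring.
Unshelve. all: end_near. Qed.

Lemma weight_integrable p a : 0 < a ->
  (@lebesgue_measure R).-integrable `[-1, 1]
    (EFin \o (fun x => p.[x] * (1 - x ^+ 2) `^ a)).
Proof.
move=> a0; apply: continuous_compact_integrable; first exact: segment_compact.
exact/derivable_oo_LRcontinuous_within/weight_LRcontinuous.
Qed.

(** With [a = (n - 3) / 2] and [p] a product of two polynomials, this is the real-valued form of the
    integral in the orthogonality relation. *)
Definition wint a p : R :=
  \int[@lebesgue_measure R]_(x in `[-1, 1]) (p.[x] * (1 - x ^+ 2) `^ a).

Lemma wintD a p q : 0 < a -> wint a (p + q) = wint a p + wint a q.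
Proof.
move=> a0; rewrite /wint -RintegralD//; try exact: weight_integrable.
by apply: eq_Rintegral => x _; rewrite hornerD mulrDl.
Qed.

Lemma wintZ a c p : 0 < a -> wint a (c *: p) = c * wint a p.
Proof.
move=> a0; rewrite /wint -RintegralZl//; last exact: weight_integrable.
by apply: eq_Rintegral => x _; rewrite hornerZ mulrA.
Qed.

Lemma wintN a p : 0 < a -> wint a (- p) = - wint a p.
Proof. by move=> a0; rewrite -scaleN1r wintZ // mulN1r. Qed.

(** The integrand is the derivative of [p (1 - x^2)^(a + 1)], which vanishes at both endpoints. *)
Lemma wint_deriv a p : 0 < a ->
  wint a ((1 - 'X^2) * p^`() - (2 * a + 2) *: ('X * p)) = 0.
Proof.
move=> a0; rewrite /wint /Rintegral.
rewrite (@continuous_FTC2 _ _ (fun x => p.[x] * (1 - x ^+ 2) `^ (a + 1))) //.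
- rewrite sqrrN expr1n subrr powR0; first by rewrite !mulr0 -EFinB subrr.
  by rewrite gt_eqF// addr_gt0.
- exact/derivable_oo_LRcontinuous_within/weight_LRcontinuous.
- by apply: weight_LRcontinuous; rewrite addr_gt0.
- move=> x; rewrite in_itv /= => xI; rewrite derive1E.
  by have [_] := is_derive_poly_weight p a xI.
Qed.

Lemma finite_roots p : p != 0 -> finite_set [set x | root p x].
Proof.
elim: {p}(size p) {-2}p (leqnn (size p)) => [|n IHn] p.
  by rewrite leqn0 size_poly_eq0 => /eqP->; rewrite eqxx.
move=> sp p0; have [[x rx]|nr] := pselect (exists x, root p x); last first.
  by rewrite [X in finite_set X](_ : _ = set0)// -subset0 => x rx; apply: nr; exists x.
have /factor_theorem[q pE] := rx.
have q0 : q != 0 by apply: contraNneq p0 => q0; rewrite pE q0 mul0r.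
apply: (@sub_finite_set _ _ ([set x] `|` [set y | root q y])).
  by move=> y /=; rewrite pE rootM root_XsubC => /orP[|/eqP->]; [right|left].
rewrite finite_setU; split; first exact: finite_set1.
apply: IHn => //; move: sp; rewrite pE size_Mmonic ?monicXsubC// size_XsubC.
by rewrite addn2.
Qed.

(** A nonnegative integrand with zero integral vanishes almost everywhere. For [p] nonzero it
    vanishes only at finitely many points, so [[-1, 1]] would be a null set. *)
Lemma wint_sqr_eq0 a p : 0 < a -> wint a (p ^+ 2) = 0 -> p = 0.
Proof.
move=> a0 I0; apply/eqP/negP => /negP p0.
have iw := weight_integrable (p ^+ 2) a0.
have mI : measurable (`[-1, 1] : set R) by exact: measurable_itv.
have : (\int[@lebesgue_measure R]_(x in `[(-1)%R, 1%R])
   `| ((p ^+ 2).[x] * (1 - x ^+ 2) `^ a)%R%:E | = 0)%E.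
  rewrite -[RHS]/(0%:E) -I0 /wint /Rintegral fineK; last exact: integrable_fin_num.
  apply: eq_integral => x _; congr (_%:E).
  by rewrite ger0_norm // mulr_ge0 ?powR_ge0// horner_exp sqr_ge0.
move/(proj1 (ae_eq_integral_abs lebesgue_measure mI (measurable_int _ iw))) => ae0.
(* The factor [1 - 'X^2] accounts for the zeros of the weight itself. *)
have fin : finite_set [set x | root (p * (1 - 'X^2)) x].
  apply: finite_roots; rewrite mulf_neq0// -size_poly_eq0 -opprB size_polyN.
  by rewrite size_XnsubC.
have : lebesgue_measure (`[-1, 1]%classic : set R) = 0%E.
  apply: measure_negligible => //; apply: negligibleS (negligibleU ae0 _).
    move=> x xI; have [rx|nrx] := boolP (root (p * (1 - 'X^2)) x); first by right; exact: rx.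
    left => /(_ xI) /= [] /eqP; rewrite mulf_eq0 powR_eq0 horner_exp expf_eq0 /=.
    by apply/negP; move: nrx; rewrite rootM /root !hornerE; case: eqP => //= _; case: eqP.
  apply/negligibleP; first exact/countable_measurable/finite_set_countable.
  exact/countable_lebesgue_measure0/finite_set_countable.
rewrite lebesgue_measure_itv /= lte_fin ifT; last by lra.
by rewrite -EFinB => -[]; lra.
Qed.

End weighted_integral.

(** * The Gegenbauer operator and the coefficient recurrence *)

Section gegenbauer_operator.
Variable R : realType.
Implicit Types (a : R) (p q : {poly R}).

(** Sturm-Liouville form: on [(-1, 1)] this is [(1 - x^2)^(-a)] times the derivative of
    [(1 - x^2)^(a + 1) p']. For [a = (n - 3) / 2] the factor [2 a + 2] is [n - 1]. *)
Definition gegen_op a p : {poly R} :=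
  (1 - 'X^2) * p^`()^`() - (2 * a + 2) *: ('X * p^`()).

(** The difference of the two integrands is an exact derivative, given by [wint_deriv] at the
    Wronskian [p' q - p q']. *)
Lemma gegen_op_selfadjoint a p q : 0 < a ->
  wint a (gegen_op a p * q) = wint a (p * gegen_op a q).
Proof.
move=> a0; apply/eqP; rewrite -subr_eq0 -wintN // -wintD //.
rewrite -[X in _ == X](wint_deriv (p^`() * q - p * q^`()) a0).
apply/eqP; congr wint; rewrite /gegen_op derivB !derivM -!mul_polyC; ring.
Qed.

Lemma coef_gegen_op a p i : (gegen_op a p)`_i =
  i.+2%:R * i.+1%:R * p`_i.+2 - i%:R * (i%:R + 2 * a + 1) * p`_i.
Proof.
rewrite /gegen_op mulrBl mul1r !coefB coefZ coefXnM coefXM.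
case: i => [|[|i]] /=; rewrite !coef_deriv ?subSS ?subn0//=; ring.
Qed.

Lemma size_gegen_op a p n : (size p <= n)%N -> (size (gegen_op a p) <= n)%N.
Proof.
move=> sp; apply/leq_sizeP => i /(leq_trans sp) pi.
by rewrite coef_gegen_op !nth_default ?mulr0 ?subrr// (leq_trans pi)// leqW.
Qed.

(** As each [Q j] has degree exactly [j], subtracting a multiple of [Q n] removes the leading term
    of [p]; induction on the size does the rest. *)
Lemma orthogonal_lower a (Q : nat -> {poly R}) : 0 < a ->
  (forall k, size (Q k) = k.+1) ->
  (forall j k, j <> k -> wint a (Q j * Q k) = 0) ->
  forall k p, (size p <= k)%N -> wint a (Q k * p) = 0.
Proof.
move=> a0 sQ oQ k p; elim: {p}(size p) {-2}p (leqnn (size p)) => [|n IHn] p.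
  rewrite leqn0 size_poly_eq0 => /eqP-> _.
  by rewrite mulr0 -(scale0r 0) wintZ // mul0r.
move=> spn spk; case: (ltnP (size p) n.+1) => [|sp]; first by move=> /IHn; apply.
have {spn sp} spn : size p = n.+1 by apply/eqP; rewrite eqn_leq spn.
have Qn : lead_coef (Q n) != 0 by rewrite lead_coef_eq0 -size_poly_eq0 sQ.
pose c := lead_coef p / lead_coef (Q n).
have -> : p = (p - c *: Q n) + c *: Q n by rewrite subrK.
rewrite mulrDr wintD // -scalerAr wintZ // oQ; last by lia.
rewrite mulr0 addr0; have s : (size (p - c *: Q n)%R <= n)%N.
  apply/leq_sizeP => i; rewrite leq_eqVlt coefB coefZ => /predU1P[<-|ni].
    rewrite /c !lead_coefE spn sQ /= divfK ?subrr //.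
    by move: Qn; rewrite lead_coefE sQ.
  by rewrite !nth_default ?mulr0 ?subrr// ?spn ?sQ.
by apply: IHn => //; lia.
Qed.

(** The eigenvalue cancels the coefficient of [x^k], so the residue [r] has degree below [k], and so
    has its image under the operator. Self-adjointness then makes [r] orthogonal to itself, hence
    zero. *)
Lemma gegenbauer_ode a (Q : nat -> {poly R}) : 0 < a ->
  (forall k, size (Q k) = k.+1) ->
  (forall j k, j <> k -> wint a (Q j * Q k) = 0) ->
  forall k, gegen_op a (Q k) + (k%:R * (k%:R + 2 * a + 1)) *: Q k = 0.
Proof.
move=> a0 sQ oQ k; set r := _ + _; have lo := orthogonal_lower a0 sQ oQ.
have sr : (size r <= k)%N.
  apply/leq_sizeP => i; rewrite /r coefD coef_gegen_op coefZ leq_eqVlt.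
  move=> /predU1P[<-|ni]; last by rewrite !nth_default ?sQ//; [ring|lia].
  by rewrite (@nth_default _ _ _ k.+2) ?sQ//; ring.
apply: (wint_sqr_eq0 a0); rewrite expr2 {1}/r mulrDl wintD // gegen_op_selfadjoint //.
by rewrite -scalerAl wintZ // !lo ?mulr0 ?addr0 // size_gegen_op.
Qed.

(** Coefficient of [x^i] in the differential equation, with the difference of eigenvalues
    [k (k + 2 a + 1) - i (i + 2 a + 1)] factored. *)
Lemma gegenbauer_coef a (Q : nat -> {poly R}) : 0 < a ->
  (forall k, size (Q k) = k.+1) ->
  (forall j k, j <> k -> wint a (Q j * Q k) = 0) ->
  forall k i, (k%:R - i%:R) * (k%:R + i%:R + 2 * a + 1) * (Q k)`_i =
    - (i.+2%:R * i.+1%:R) * (Q k)`_i.+2.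
Proof.
move=> a0 sQ oQ k i; have /(congr1 (fun p : {poly R} => p`_i)) := gegenbauer_ode a0 sQ oQ k.
rewrite coefD coef_gegen_op coefZ coef0 => E.
by rewrite -[RHS]addr0 -[in X in _ = _ + X]E; ring.
Qed.

End gegenbauer_operator.

(** * Asymptotics of binomials and of the harmonic dimension *)

Section limits.
Variable R : realType.

Lemma cvg_invn : (n%:R^-1 : R) @[n --> \oo] --> (0 : R).
Proof.
apply/(@gtr0_cvgV0 R nat \oo _ (fun n => n%:R)); last exact: cvgr_idn.
by near=> n; rewrite ltr0n; near: n; exact: nbhs_infty_gt.
Unshelve. all: end_near. Qed.

Lemma cvg_invnX d : (n%:R^-1 ^+ d : R) @[n --> \oo] --> (0 ^+ d : R).
Proof. exact: continuous_cvg (@exprn_continuous R d 0) cvg_invn. Qed.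

Lemma cvg_natr_ratio (b c : nat) :
  (n + b - c)%N%:R / n%:R @[n --> \oo] --> (1 : R).
Proof.
have H : (1 + (b%:R - c%:R) * n%:R^-1 : R) @[n --> \oo] --> (1 + (b%:R - c%:R) * 0 : R).
  apply: cvgD; first exact: cvg_cst.
  by apply: cvgM; [exact: cvg_cst|exact: cvg_invn].
rewrite mulr0 addr0 in H; apply: cvg_trans H; apply: near_eq_cvg; near=> n.
have n0 : (0 < n)%N by near: n; exact: nbhs_infty_gt.
have nc : (c <= n)%N by near: n; exact: nbhs_infty_ge.
rewrite natrB ?natrD; last by lia.
by field; rewrite pnatr_eq0 -lt0n.
Unshelve. all: end_near. Qed.

Lemma cvg_ffact_ratio (b c k : nat) :
  ((n + b - c) ^_ k)%N%:R / n%:R ^+ k @[n --> \oo] --> (1 : R).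
Proof.
elim: k => [|k IHk].
  rewrite (_ : (fun n => _) = cst 1); first exact: cvg_cst.
  by apply/funext => n; rewrite ffactn0 expr0 divr1.
rewrite -[X in _ --> X]mulr1.
rewrite (_ : (fun n => _) = (fun n => ((n + b - c) ^_ k)%:R / n%:R ^+ k *
    ((n + b - (c + k))%:R / n%:R))); first exact: cvgM IHk (@cvg_natr_ratio b (c + k)).
by apply/funext => n; rewrite ffactnSr natrM exprSr subnDA invfM mulrACA.
Qed.

Lemma cvg_bin_ratio (b c k : nat) :
  'C(n + b - c, k)%:R / n%:R ^+ k @[n --> \oo] --> (k`!%:R^-1 : R).
Proof.
rewrite -[X in _ --> X]mul1r.
rewrite (_ : (fun n => _) = (fun n => ((n + b - c) ^_ k)%:R / n%:R ^+ k * k`!%:R^-1)).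
  exact: cvgM (@cvg_ffact_ratio b c k) (cvg_cst _).
by apply/funext => n; rewrite -bin_ffact natrM mulrAC mulfK.
Qed.

(** By symmetry the binomials are [C(n + k - 1, k)] and [C(n + k - 3, k - 2)]. The second has order
    [n^(k - 2)] and disappears in the limit. *)
Lemma cvg_harm_dim (k : nat) : (2 <= k)%N ->
  (harm_dim n k)%:R / n%:R ^+ k @[n --> \oo] --> (k`!%:R^-1 : R).
Proof.
case: k => [|[|k]] // _; 
have H : ('C(n + k.+2 - 1, k.+2)%:R / n%:R ^+ k.+2 -
    'C(n + k.+2 - 3, k)%:R / n%:R ^+ k * (n%:R^-1 * n%:R^-1) : R) @[n --> \oo] -->
    (k.+2`!%:R^-1 - k`!%:R^-1 * (0 * 0) : R).
  apply: cvgB; first exact: cvg_bin_ratio.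
  apply: cvgM; first exact: cvg_bin_ratio.
  by apply: cvgM; exact: cvg_invn.
rewrite !mulr0 subr0 in H; apply: cvg_trans H; apply: near_eq_cvg; near=> n.
have n0 : (0 < n)%N by near: n; exact: nbhs_infty_gt.
rewrite /harm_dim natrB; last first.
  by rewrite (leq_trans (leq_bin2l _ (_ : (_ <= n + k.+2 - 1)%N)))//; lia.
have E : n%:R != 0 :> R by rewrite pnatr_eq0 -lt0n.
have -> : (n + k.+2 - 1 = k.+2 + (n - 1))%N by lia.
have -> : (n + k.+2 - 3 = k + (n - 1))%N by lia.
rewrite -(bin_sub (leq_addr (n - 1) k)) -(bin_sub (leq_addr (n - 1) k.+2)) !addKn !exprS.
by field; rewrite expf_neq0 ?E.
Unshelve. all: end_near. Qed.

End limits.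

(** * The limiting Hermite polynomial in the variable [z = y^2] *)

Section hermite_limit.
Variables (R : realType) (e : nat).

Definition hermite_coef (m : nat) : R :=
  (-1) ^+ (e - m) / ((e - m)`!%:R * 2 ^+ (e - m) * (2 * m)`!%:R).

(* [hermite_sq.[y ^+ 2]] is the probabilists' Hermite polynomial [He_(2e)(y) / (2e)!]. *)
Definition hermite_sq : {poly R} := \poly_(m < e.+1) hermite_coef m.

(** This is the limit, after rescaling by powers of [n], of the Gegenbauer recurrence with [k = 2 e]
    and [i = 2 m]. *)
Lemma hermite_coefS m : (m < e)%N ->
  (2 * m).+2%:R * (2 * m).+1%:R * hermite_coef m.+1 +
  2 * (e%:R - m%:R) * hermite_coef m = 0.
Proof.
move=> me; rewrite /hermite_coef.
have -> : (e - m = (e - m.+1).+1)%N by lia.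
have -> : e%:R - m%:R = (e - m.+1).+1%:R :> R by rewrite -natrB ?subnSK// ltnW.
have -> : (2 * m.+1 = (2 * m).+2)%N by lia.
move: (e - m.+1)%N => d; rewrite !factS !natrM !exprS.
field.
by rewrite expf_neq0 ?pnatr_eq0 -?natrM ?nat1r -?natrD ?pnatr_eq0 -?lt0n ?fact_gt0.
Qed.

Lemma hermite_coef_top : hermite_coef e = (2 * e)`!%:R^-1.
Proof. by rewrite /hermite_coef subnn !expr0 fact0 !mul1r. Qed.

(** The Hermite equation [u'' - y u' + 2 e u = 0] for [u(y) = H(y^2)], rewritten in [z = y^2]. *)
Lemma hermite_sq_ode :
  4 *: ('X * hermite_sq^`()^`()) + 2 *: hermite_sq^`() - 2 *: ('X * hermite_sq^`())
  + (2 * e)%:R *: hermite_sq = 0.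
Proof.
apply/polyP => i.
have coefXD (p : {poly R}) : ('X * p^`())`_i = p`_i *+ i.
  by rewrite coefXM coef_deriv; case: i.
rewrite coef0 !(coefD, coefN, coefZ, coefXD, coef_deriv).
rewrite /hermite_sq !coef_poly !ltnS; case: (ltngtP i e) => ie.
- by rewrite -(hermite_coefS ie) natrM -!natr1 !natrM; ring.
- by ring.
- by rewrite ie natrM; ring.
Qed.

Lemma size_hermite_sq : size hermite_sq = e.+1.
Proof.
by rewrite size_poly_eq// hermite_coef_top invr_neq0// pnatr_eq0 -lt0n fact_gt0.
Qed.

Lemma lead_coef_hermite_sq : lead_coef hermite_sq = (2 * e)`!%:R^-1.
Proof.
by rewrite lead_coefE size_hermite_sq coef_poly ltnSn hermite_coef_top.
Qed.

(** For [z >= 1] the lower terms total at most [C z^(d - 1)] in absolute value, which is at most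
    half the leading term once [z >= 2 C / lead_coef p]. *)
Lemma horner_ge_half_lead (p : {poly R}) d : size p = d.+1 -> 0 < lead_coef p ->
  exists2 Z : R, 1 <= Z & forall z, Z <= z -> lead_coef p / 2 * z ^+ d <= p.[z].
Proof.
move=> sp l0; pose C := \sum_(i < d) `|p`_i|.
have C0 : 0 <= C by apply: sumr_ge0.
have K : 0 <= 2 * C / lead_coef p by rewrite divr_ge0 ?mulr_ge0// ltW.
exists (1 + 2 * C / lead_coef p) => [|z zZ]; first by rewrite lerDl.
have z1 : 1 <= z by apply: le_trans zZ; rewrite lerDl.
have z0 : 0 <= z by apply: le_trans z1.
have -> : p.[z] = \sum_(i < d) p`_i * z ^+ i + lead_coef p * z ^+ d.
  by rewrite horner_coef sp big_ord_recr /= lead_coefE sp.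
case: d sp @C C0 K zZ => [|d] sp C C0 K zZ.
  by rewrite big_ord0 add0r expr0; lra.
have H : - (C * z ^+ d) <= \sum_(i < d.+1) p`_i * z ^+ i.
  rewrite /C mulr_suml -sumrN; apply: ler_sum => i _.
  apply: (@le_trans _ _ (- `|p`_i * z ^+ i|)); last first.
    by have := ler_norm (- (p`_i * z ^+ i)); rewrite normrN; lra.
  rewrite lerN2 normrM normrX (ger0_norm z0) ler_wpM2l// ler_weXn2l//.
  by rewrite -ltnS.
have Cz : C <= lead_coef p / 2 * z.
  suff : 2 * C / lead_coef p <= z by rewrite ler_pdivrMr//; lra.
  by lra.
have zd : 0 <= z ^+ d by rewrite exprn_ge0.
have := ler_wpM2r zd Cz; rewrite exprS; lra.
Qed.

Lemma is_derive_nonincreasing (f df : R -> R) :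
  (forall x : R, is_derive x (1 : R) f (df x)) -> (forall x, 0 <= x -> df x <= 0) ->
  forall y, 0 <= y -> f y <= f 0.
Proof.
move=> dfE df0 y y0; apply: (@ler0_derive1_nincry _ f 0) => // [x|].
- by rewrite in_itv /= andbT derive1E => /ltW/df0; have [_ ->] := dfE x.
- apply: continuous_subspaceT => x; apply/differentiable_continuous/derivable1_diffP.
  by have [] := dfE x.
Qed.

(* Otherwise [u(y) = H(y^2)], which solves [u'' - y u' + 2 e u = 0], would make
   [exp(-y^2/2) u'] nonincreasing, hence [u] nonincreasing on [y >= 0]. *)
Lemma hermite_sq_neg : (0 < e)%N -> exists2 z : R, 0 <= z & hermite_sq.[z] < 0.
Proof.
move=> e_gt0; apply: contrapT => nneg.
have H0 (z : R) : 0 <= z -> 0 <= hermite_sq.[z].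
  by move=> z0; rewrite leNgt; apply/negP => Hz; apply: nneg; exists z.
pose u : {poly R} := hermite_sq \Po 'X^2.
have uode y : u^`()^`().[y] - y * u^`().[y] = - ((2 * e)%:R * u.[y]).
  have := congr1 (fun p => p.[y ^+ 2]) hermite_sq_ode.
  rewrite /u !(deriv_comp, derivM, derivD, derivXn, derivX, derivC, derivMn).
  rewrite !(hornerE, horner_comp) /= => E.
  by rewrite -[RHS]addr0 -[in X in _ = _ + X]E; ring.
pose w : {poly R} := - 2^-1 *: 'X^2.
pose g y := expR w.[y] * u^`().[y].
have dg (y : R) : is_derive y (1 : R) g (- (expR w.[y] * ((2 * e)%:R * u.[y]))).
  have de : is_derive y (1 : R) (fun y => expR w.[y]) (expR w.[y] * - y).
    have := @is_derive1_comp R expR (horner w) y _ _ (is_derive_expR _) (is_derive_poly w y).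
    have -> : w^`().[y] = - y by rewrite /w derivZ derivXn !hornerE /=; field.
    exact.
  apply: is_derive_eq; rewrite /GRing.scale /= -mulrN -uode; ring.
have g0 y : 0 <= y -> g y <= 0.
  (* [u] is a polynomial in [y^2], so [u'(0) = 0]. *)
  move=> y0; have -> : 0 = g 0.
    by rewrite /g /u deriv_comp derivXn !hornerE /= expr1 mulr0.
  apply: (is_derive_nonincreasing dg _ y0) => x x0.
  rewrite oppr_le0 mulr_ge0 ?expR_ge0// mulr_ge0// /u horner_comp H0//.
  by rewrite !hornerE /= sqr_ge0.
have ninc y : 0 <= y -> u.[y] <= u.[0].
  apply: (is_derive_nonincreasing (is_derive_poly u)) => x x0.
  by have := g0 x x0; rewrite /g pmulr_rle0// expR_gt0.
have l0 : 0 < lead_coef hermite_sq.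
  by rewrite lead_coef_hermite_sq invr_gt0 ltr0n fact_gt0.
have [Z Z1 HZ] := horner_ge_half_lead size_hermite_sq l0.
(* Chosen so that half the leading coefficient times [z] exceeds [H(0)]. As [z <= z^e], this gives
   [H(z) > H(0)], against the monotonicity of [u]. *)
pose z := Z + 2 * hermite_sq.[0] / lead_coef hermite_sq.
have Zz : Z <= z by rewrite lerDl divr_ge0 ?mulr_ge0 ?H0// ltW.
have z1 : 1 <= z by apply: le_trans Zz.
have z0 : 0 <= z by apply: le_trans z1.
have := ninc (Num.sqrt z) (sqrtr_ge0 _).
rewrite /u !horner_comp !hornerE /= sqr_sqrtr// expr0n /=; apply/negP; rewrite -ltNge.
apply: lt_le_trans (HZ _ Zz); apply: (@lt_le_trans _ _ (lead_coef hermite_sq / 2 * z)).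
  rewrite /z mulrDr [X in _ < _ + X](_ : _ = hermite_sq.[0]).
    by rewrite ltrDr mulr_gt0 ?divr_gt0// (lt_le_trans ltr01).
  by field; rewrite gt_eqF.
by rewrite ler_wpM2l ?ler_eXnr// divr_ge0// ltW.
Qed.

End hermite_limit.

(** * Coefficientwise convergence and minima over the half-line *)

Section polynomial_convergence.
Variable R : realType.

(** Termwise, [z^i <= y^i <= y^d]. Leaving [y] free lets one estimate serve a bounded range, with
    [y] fixed, and the tail, with [y = z]. *)
Lemma horner_dist_near (P : nat -> {poly R}) (p : {poly R}) d :
  size p = d.+1 -> (forall n, (size (P n) <= d.+1)%N) ->
  (forall i, (i < d.+1)%N -> (P n)`_i @[n --> \oo] --> p`_i) ->
  forall delta : R, 0 < delta ->
  \forall n \near \oo, forall y z : R, 1 <= y -> 0 <= z -> z <= y ->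
    `|p.[z] - (P n).[z]| <= delta * y ^+ d.
Proof.
move=> sp sP cP delta d0.
have e0 : 0 < delta / d.+1%:R by rewrite divr_gt0 ?ltr0n.
have H : \forall n \near \oo, forall i : 'I_d.+1,
    `|p`_i - (P n)`_i| <= delta / d.+1%:R.
  by apply: filter_forall => i; move/cvgrPdist_le: (cP i (ltn_ord i)); exact.
apply: filterS H => n H y z y1 z0 zy.
have -> : p.[z] - (P n).[z] = \sum_(i < d.+1) (p`_i - (P n)`_i) * z ^+ i.
  rewrite (horner_coef_wide _ (sP n)) horner_coef sp -sumrB.
  by apply: eq_bigr => i _; rewrite mulrBl.
apply: le_trans (ler_norm_sum _ _ _) _.
have -> : delta * y ^+ d = \sum_(i < d.+1) (delta / d.+1%:R * y ^+ d).
  by rewrite sumr_const card_ord -mulr_natr; field; rewrite nat1r pnatr_eq0.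
apply: ler_sum => i _; rewrite normrM; apply: ler_pM => //.
rewrite normrX ger0_norm//; apply: (@le_trans _ _ (y ^+ i)).
  by apply: lerXn2r; rewrite ?nnegrE // (le_trans z0).
by apply: ler_weXn2l => //; rewrite -ltnS.
Qed.

(** On [[0, Z]] the polynomials are within [eps] of [p]. Beyond [Z] the error is at most half the
    leading term, which bounds [p] from below, so the value is nonnegative and [mu <= 0]
    suffices. *)
Lemma horner_lower_near (P : nat -> {poly R}) (p : {poly R}) d (mu : R) :
  size p = d.+1 -> (forall n, (size (P n) <= d.+1)%N) ->
  (forall i, (i < d.+1)%N -> (P n)`_i @[n --> \oo] --> p`_i) ->
  0 < lead_coef p -> mu <= 0 -> (forall z, 0 <= z -> mu <= p.[z]) ->
  forall eps : R, 0 < eps ->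
  \forall n \near \oo, forall z : R, 0 <= z -> mu - eps <= (P n).[z].
Proof.
move=> sp sP cP l0 mu0 lb eps e0.
have [Z Z1 HZ] := horner_ge_half_lead sp l0.
have Zd : 0 < Z ^+ d by rewrite exprn_gt0// (lt_le_trans ltr01).
pose delta := Num.min (eps / Z ^+ d) (lead_coef p / 2).
have d0 : 0 < delta by rewrite lt_min !divr_gt0.
have := horner_dist_near sp sP cP d0; apply: filterS => n H z z0.
have [zZ|Zz] := leP z Z.
  have := H Z z Z1 z0 zZ; have : delta * Z ^+ d <= eps.
    by rewrite -ler_pdivlMr// /delta ge_min lexx.
  by rewrite ler_norml => ? /andP[_]; have := lb z z0; lra.
have z1 : 1 <= z by rewrite (le_trans Z1)// ltW.
have zd : 0 <= z ^+ d by rewrite exprn_ge0.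
have := H z z z1 z0 (lexx z); have := HZ z (ltW Zz).
have : delta * z ^+ d <= lead_coef p / 2 * z ^+ d.
  by rewrite ler_wpM2r// /delta ge_min lexx orbT.
by rewrite ler_norml => ? ? /andP[_]; lra.
Qed.

(** Beyond some [Z] the polynomial is nonnegative, so a negative value occurs before [Z] and the
    minimum over the compact [[0, Z]] is global. *)
Lemma horner_min_attained (p : {poly R}) d : size p = d.+1 -> 0 < lead_coef p ->
  (exists2 z : R, 0 <= z & p.[z] < 0) ->
  exists z0 : R, [/\ 0 <= z0, p.[z0] < 0 & forall z, 0 <= z -> p.[z0] <= p.[z]].
Proof.
move=> sp l0 [z1 z10 pz1]; have [Z Z1 HZ] := horner_ge_half_lead sp l0.
have pZ z : Z <= z -> 0 <= p.[z].
  move=> Zz; apply: le_trans (HZ z Zz); rewrite mulr_ge0 ?divr_ge0 ?(ltW l0)//.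
  by rewrite exprn_ge0// (le_trans _ Zz)// (le_trans _ Z1).
have Z0 : 0 <= Z by rewrite (le_trans _ Z1).
have [c + minc] := EVT_min Z0 (continuous_subspaceT (@continuous_horner _ p)).
rewrite in_itv /= => /andP[c0 cZ].
have c1 : p.[c] <= p.[z1].
  by apply: minc; rewrite in_itv /= z10 leNgt; apply: contraTN pz1 => /ltW/pZ; rewrite leNgt.
exists c; split => // [|z z0]; first exact: le_lt_trans pz1.
have [zZ|/ltW/pZ] := leP z Z; first by apply: minc; rewrite in_itv /= z0.
by apply: le_trans; rewrite ltW// (le_lt_trans c1).
Qed.

End polynomial_convergence.

(** * Convergence of the rescaled Gegenbauer polynomials *)

Section gegenbauer_limit.
Variables (R : realType) (Q : nat -> nat -> {poly R}).
Hypothesis gQ : is_gegenbauer Q.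

(** Here [a = (n - 3) / 2], so [2 a + 1 = n - 2]; the bound [4 <= n] makes [a] positive. *)
Lemma gegenbauer_coef_rec n k i : (4 <= n)%N ->
  (k%:R - i%:R) * (n + (k + i) - 2)%:R * (Q n k)`_i =
    - (i.+2%:R * i.+1%:R) * (Q n k)`_i.+2.
Proof.
move=> n4; have n2 : (2 <= n)%N by lia.
have [sQ [oQ _]] := gQ n2.
have a0 : 0 < (n%:R - 3) / 2 :> R.
  by rewrite divr_gt0// subr_gt0 ltr_nat.
have oQ' j l : j <> l -> wint ((n%:R - 3) / 2) (Q n j * Q n l) = 0.
  move=> /oQ I0; rewrite /wint /Rintegral.
  by under eq_integral do rewrite hornerM; rewrite I0.
rewrite -(gegenbauer_coef a0 sQ oQ').
rewrite natrB ?natrD; last by lia.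
by congr (_ * _ * _); field.
Qed.

Variable e : nat.

(** Descending induction from indices above the degree: the recurrence ties [i] to [i + 2], and its
    left factor is nonzero for odd [i] below [2 e]. *)
Lemma gegenbauer_odd_coef n i : (4 <= n)%N -> odd i -> (Q n (2 * e))`_i = 0.
Proof.
move=> n4; have n2 : (2 <= n)%N by lia.
have [sQ _] := gQ n2.
have [d] : exists d, (2 * e <= i + d)%N by exists (2 * e)%N; lia.
elim: d i => [|d IHd] i ile oi.
  by rewrite nth_default// sQ; move: oi ile; lia.
have [lei|lti] := leqP (2 * e) i; first by rewrite nth_default// sQ; move: oi lei; lia.
have /eqP := gegenbauer_coef_rec (2 * e) i n4.
rewrite (IHd i.+2) ?oi//= ?negbK//; last by lia.
rewrite mulr0 !mulf_eq0 subr_eq0 eqr_nat pnatr_eq0 => /orP[/orP[]|/eqP//]; lia.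
Qed.

(** In the divisor, [n^m] comes from the substitution [z = n x^2] and [n^e] from the overall
    normalization. *)
Definition scaled_gegenbauer n : {poly R} :=
  \poly_(m < e.+1) ((Q n (2 * e))`_(2 * m) / n%:R ^+ (m + e)).

Lemma gegenbauer_even n x : (4 <= n)%N ->
  (Q n (2 * e)).[x] = \sum_(m < e.+1) (Q n (2 * e))`_(2 * m) * (x ^+ 2) ^+ m.
Proof.
move=> n4; have n2 : (2 <= n)%N by lia.
have [sQ _] := gQ n2.
rewrite -{1}[Q n _]poly_even_odd.
have -> : odd_poly (Q n (2 * e)) = 0.
  by apply/polyP => i; rewrite coef_odd_poly coef0 gegenbauer_odd_coef//= odd_double.
rewrite comp_poly0 mul0r addr0 horner_comp hornerXn.
rewrite (@horner_coef_wide _ e.+1); last first.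
  by apply: leq_trans (size_even_poly _) _; rewrite sQ mul2n /= doubleK.
by apply: eq_bigr => i _; rewrite coef_even_poly -mul2n.
Qed.

Lemma gegenbauer_scaled n x : (4 <= n)%N ->
  (Q n (2 * e)).[x] = n%:R ^+ e * (scaled_gegenbauer n).[n%:R * x ^+ 2].
Proof.
move=> n4; rewrite gegenbauer_even// horner_poly mulr_sumr; apply: eq_bigr => i _.
have n0 j : n%:R ^+ j != 0 :> R by rewrite expf_neq0// pnatr_eq0; lia.
move: (x ^+ 2) => y; rewrite exprMn exprD.
by field; rewrite !n0.
Qed.

Lemma gegenbauer_lead_neq0 n : (4 <= n)%N -> (Q n (2 * e))`_(2 * e) != 0.
Proof.
move=> n4; have n2 : (2 <= n)%N by lia.
have [sQ _] := gQ n2; have := sQ (2 * e)%N => s.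
by rewrite -[X in _`_X]/((2 * e).+1.-1) -s -lead_coefE lead_coef_eq0 -size_poly_eq0 s.
Qed.

(** Induction downwards from the top coefficient. Dividing by that coefficient leaves only the
    recurrence, whose limit is the Hermite one. *)
Lemma cvg_coef_ratio d : (d <= e)%N ->
  (Q n (2 * e))`_(2 * (e - d)) * n%:R ^+ d / (Q n (2 * e))`_(2 * e) @[n --> \oo] -->
  hermite_coef R e (e - d) * (2 * e)`!%:R.
Proof.
have f0 : (2 * e)`!%:R != 0 :> R by rewrite pnatr_eq0 -lt0n fact_gt0.
have Q0 := gegenbauer_lead_neq0.
elim: d => [_|d IHd de].
  rewrite subn0 hermite_coef_top mulVf//.
  apply: cvg_near_cst; near=> n; rewrite expr0 mulr1 divff// Q0//.
  by near: n; exact: nbhs_infty_ge.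
have {}IHd := IHd (ltnW de).
set m := (e - d.+1)%N; have me : (m < e)%N by rewrite /m; lia.
have mE : (e - d = m.+1)%N by rewrite /m; lia.
rewrite mE in IHd.
have em0 : e%:R - m%:R != 0 :> R by rewrite subr_eq0 eqr_nat; lia.
(* The limit of [n] times the ratio of the coefficients of index [2 m] and [2 m + 2]. *)
pose K : R := - ((2 * m).+2%:R * (2 * m).+1%:R) / (2 * (e%:R - m%:R)).
have H : (K * ((n + (2 * e + 2 * m) - 2)%N%:R / n%:R)^-1 *
  ((Q n (2 * e))`_(2 * m.+1) * n%:R ^+ d / (Q n (2 * e))`_(2 * e))) @[n --> \oo] -->
  (K * 1^-1 * (hermite_coef R e m.+1 * (2 * e)`!%:R)).
  apply: cvgM IHd; apply: cvgM; first exact: cvg_cst.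
  by apply: cvgV; [exact: oner_neq0 | exact: cvg_natr_ratio].
have -> : hermite_coef R e m * (2 * e)`!%:R =
    K * 1^-1 * (hermite_coef R e m.+1 * (2 * e)`!%:R).
  rewrite invr1 mulr1 mulrA; congr (_ * _); rewrite /K.
  apply: (@mulfI _ (2 * (e%:R - m%:R))); first by rewrite mulf_neq0// pnatr_eq0.
  have /eqP := hermite_coefS R me; rewrite addrC addr_eq0 => /eqP->.
  by field.
apply: cvg_trans H; apply: near_eq_cvg; near=> n.
have n4 : (4 <= n)%N by near: n; exact: nbhs_infty_ge.
have n0 : n%:R != 0 :> R by rewrite pnatr_eq0; lia.
have N0 : (n + (2 * e + 2 * m) - 2)%:R != 0 :> R by rewrite pnatr_eq0; lia.
have E := gegenbauer_coef_rec (2 * e) (2 * m) n4.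
have -> : (2 * m.+1 = (2 * m).+2)%N by lia.
have -> : (Q n (2 * e))`_(2 * m) = - ((2 * m).+2%:R * (2 * m).+1%:R) *
   (Q n (2 * e))`_(2 * m).+2 / (2 * (e%:R - m%:R) * (n + (2 * e + 2 * m) - 2)%:R).
  by rewrite -E; move: (_%:R) N0 => N N0; rewrite !natrM; field; rewrite em0 N0.
rewrite /K /= exprS; have q0 := Q0 n n4; move: (_%:R) N0 => N N0.
by field; rewrite N0 n0 em0 q0.
Unshelve. all: end_near. Qed.

(** The value at [1] divided by the leading coefficient tends to [1], since the coefficient [d]
    places below the top is of relative order [n^(-d)]. The leading coefficient is thus asymptotic
    to [harm_dim n (2 * e)]. *)
Lemma cvg_gegenbauer_lead : (0 < e)%N ->
  (Q n (2 * e))`_(2 * e) / n%:R ^+ (2 * e) @[n --> \oo] --> ((2 * e)`!%:R^-1 : R).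
Proof.
move=> e_gt0; have f0 : (2 * e)`!%:R != 0 :> R by rewrite pnatr_eq0 -lt0n fact_gt0.
pose S n := \sum_(d < e.+1) ((Q n (2 * e))`_(2 * (e - d)) * n%:R ^+ d /
  (Q n (2 * e))`_(2 * e) * n%:R^-1 ^+ d).
have cS : S n @[n --> \oo] --> (1 : R).
  (* Since [0 ^+ 0 = 1], only the term [d = 0] survives. *)
  have -> : 1 = \sum_(d < e.+1) (hermite_coef R e (e - d) * (2 * e)`!%:R * 0 ^+ d).
    rewrite big_ord_recl big1 /= => [|i _]; last by rewrite expr0n mulr0.
    rewrite subn0 expr0 mulr1 addr0 hermite_coef_top mulVf//.
  apply: cvg_big => [|d _]; first exact: add_continuous.
  have dle : (d <= e)%N by rewrite -ltnS.
  exact: cvgM (cvg_coef_ratio dle) (@cvg_invnX R d).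
have SE n : (4 <= n)%N -> S n = (harm_dim n (2 * e))%:R / (Q n (2 * e))`_(2 * e).
  move=> n4; have n2 : (2 <= n)%N by lia.
  have [_ [_ <-]] := gQ n2; rewrite gegenbauer_even// (reindex_inj rev_ord_inj) /=.
  rewrite /S mulr_suml; apply: eq_bigr => d _; rewrite !expr1n mulr1 subSS exprVn.
  rewrite mulrAC mulfK// expf_neq0// pnatr_eq0; lia.
have H : (harm_dim n (2 * e))%:R / n%:R ^+ (2 * e) * (S n)^-1 @[n --> \oo] -->
    ((2 * e)`!%:R^-1 * 1^-1 : R).
  apply: cvgM; first by apply: cvg_harm_dim; lia.
  by apply: cvgV; [exact: oner_neq0|].
rewrite invr1 mulr1 in H; apply: cvg_trans H; apply: near_eq_cvg.
have S0 : \forall n \near \oo, S n != 0 by apply: cvgr_neq0 cS _; exact: oner_neq0.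
near=> n; have n4 : (4 <= n)%N by near: n; exact: nbhs_infty_ge.
have : S n != 0 by near: n.
rewrite /= SE// mulf_eq0 negb_or invr_eq0 => /andP[D0 q0].
have n0 : n%:R ^+ (2 * e) != 0 :> R by rewrite expf_neq0// pnatr_eq0; lia.
move: (n%:R ^+ _) n0 => N N0.
by field; rewrite D0 q0 N0.
Unshelve. all: end_near. Qed.

(** Product of the limits for the leading coefficient and for the ratio to it; the factors [(2 e)!]
    cancel. *)
Lemma cvg_scaled_coef m : (0 < e)%N -> (m < e.+1)%N ->
  (scaled_gegenbauer n)`_m @[n --> \oo] --> (hermite_sq R e)`_m.
Proof.
move=> e_gt0 me; have f0 : (2 * e)`!%:R != 0 :> R by rewrite pnatr_eq0 -lt0n fact_gt0.
have dm : (e - (e - m) = m)%N by lia.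
have H : ((Q n (2 * e))`_(2 * e) / n%:R ^+ (2 * e) * ((Q n (2 * e))`_(2 * m) *
    n%:R ^+ (e - m) / (Q n (2 * e))`_(2 * e)) : R) @[n --> \oo] -->
    ((2 * e)`!%:R^-1 * (hermite_coef R e m * (2 * e)`!%:R) : R).
  apply: cvgM; first exact: cvg_gegenbauer_lead.
  by have := @cvg_coef_ratio (e - m)%N; rewrite dm; apply; exact: leq_subr.
rewrite coef_poly me; rewrite mulrCA mulVf// mulr1 in H.
apply: cvg_trans H; apply: near_eq_cvg; near=> n.
have n4 : (4 <= n)%N by near: n; exact: nbhs_infty_ge.
have n0 j : n%:R ^+ j != 0 :> R by rewrite expf_neq0// pnatr_eq0; lia.
have q0 := gegenbauer_lead_neq0 n4.
rewrite /scaled_gegenbauer coef_poly me /=.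
have -> : n%:R ^+ (2 * e) = n%:R ^+ (m + e) * n%:R ^+ (e - m) :> R.
  by rewrite -exprD; congr (_ ^+ _); lia.
move: (n0 (m + e)%N) (n0 (e - m)%N); move: (n%:R ^+ (m + e)) (n%:R ^+ (e - m)) => a b a0 b0.
by field; rewrite a0 b0 q0.
Unshelve. all: end_near. Qed.

End gegenbauer_limit.

(** * Limits of the normalized minimum and of the resulting bound *)

Theorem theorem5p1 (R : realType) (Q : nat -> nat -> {poly R}) :
  is_gegenbauer Q ->
  forall e : nat, (2 <= e)%N ->
  exists A B : R, 0 < A /\ 0 < B /\
    (fun n : nat => c_coef Q n e / n%:R ^+ e) @ \oo --> A /\
    (fun n : nat => b_coef Q n e / n%:R ^+ e) @ \oo --> B.
Proof.
move=> gQ e e2; have e_gt0 : (0 < e)%N by lia.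
have l0 : 0 < lead_coef (hermite_sq R e).
  by rewrite lead_coef_hermite_sq invr_gt0 ltr0n fact_gt0.
have sH := size_hermite_sq R e.
have [z0 [z00 mu0 lb]] := horner_min_attained sH l0 (hermite_sq_neg R e_gt0).
set mu := (hermite_sq R e).[z0] in mu0 lb.
have sP n : (size (scaled_gegenbauer Q e n) <= e.+1)%N by exact: size_poly.
have cP i : (i < e.+1)%N -> (scaled_gegenbauer Q e n)`_i @[n --> \oo] --> (hermite_sq R e)`_i.
  exact: cvg_scaled_coef.
have cc : (fun n : nat => c_coef Q n e / n%:R ^+ e) @ \oo --> - mu.
  apply/cvgrPdist_le => eps eps0.
  have lo := horner_lower_near sH sP cP l0 (ltW mu0) lb eps0.
  (* The distance estimate needs a bound that is at least [1] and at least [z0]. *)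
  pose y := Num.max 1 z0.
  have y1 : 1 <= y by rewrite le_max lexx.
  have yd : 0 < y ^+ e by rewrite exprn_gt0// (lt_le_trans ltr01).
  have up := horner_dist_near sH sP cP (divr_gt0 eps0 yd).
  near=> n; have n4 : (4 <= n)%N by near: n; exact: nbhs_infty_ge.
  have ngt0 : 0 < n%:R :> R by rewrite ltr0n; lia.
  have ne0 : 0 < n%:R ^+ e :> R by rewrite exprn_gt0.
  have loS : lbound [set (Q n (2 * e)%N).[x] | x in `[-1, 1]] (n%:R ^+ e * (mu - eps)).
    move=> _ [x _ <-]; rewrite gegenbauer_scaled// ler_pM2l//.
    have lon : forall z, 0 <= z -> mu - eps <= (scaled_gegenbauer Q e n).[z] by near: n.
    by apply: lon; rewrite mulr_ge0 ?sqr_ge0// ltW.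
  have infS : n%:R ^+ e * (mu - eps) <= inf [set (Q n (2 * e)%N).[x] | x in `[-1, 1]].
    apply: lb_le_inf loS; exists (Q n (2 * e)%N).[1]; exists 1 => //=.
    by rewrite in_itv /= lexx andbT (le_trans _ ler01)// oppr_le0.
  have Sinf : inf [set (Q n (2 * e)%N).[x] | x in `[-1, 1]] <= n%:R ^+ e * (mu + eps).
    have zn : z0 <= n%:R by near: n; exact: nbhs_infty_ger.
    (* This test point has [n x^2 = z0], the minimizer of [H], and lies in [[-1, 1]] once
       [n >= z0]. *)
    apply: (@le_trans _ _ (Q n (2 * e)%N).[Num.sqrt (z0 / n%:R)]).
      apply: ge_inf; first by exists (n%:R ^+ e * (mu - eps)).
      exists (Num.sqrt (z0 / n%:R)) => //=; rewrite in_itv /=; apply/andP; split.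
        by rewrite (le_trans _ (sqrtr_ge0 _))// oppr_le0.
      by rewrite -[leRHS]sqrtr1 ler_wsqrtr// ler_pdivrMr// mul1r.
    rewrite gegenbauer_scaled// sqr_sqrtr ?divr_ge0 ?(ltW ngt0)// ler_pM2l//.
    rewrite mulrC divfK ?gt_eqF//.
    have upn : forall y z : R, 1 <= y -> 0 <= z -> z <= y ->
      `|(hermite_sq R e).[z] - (scaled_gegenbauer Q e n).[z]| <= 
        eps / Num.max 1 z0 ^+ e * y ^+ e by near: n.
    have zy : z0 <= y by rewrite le_max lexx orbT.
    have := upn y z0 y1 z00 zy; rewrite divfK ?gt_eqF// -/mu ler_norml => /andP[]; lra.
  rewrite /c_coef mulNr -opprD normrN; set I := inf _ in infS Sinf *.
  rewrite ler_norml; apply/andP; split.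
    suff : I / n%:R ^+ e <= mu + eps by lra.
    by rewrite ler_pdivrMr// mulrC.
  suff : mu - eps <= I / n%:R ^+ e by lra.
  by rewrite ler_pdivlMr// mulrC.
have f0 : 0 < ((2 * e)`!%:R : R) by rewrite ltr0n fact_gt0.
exists (- mu), ((2 * e)`!%:R^-1 / - mu); split; first by rewrite oppr_gt0.
split; first by rewrite divr_gt0 ?invr_gt0 ?oppr_gt0.
split => //.
(* Dividing [b_coef] by [n^e] splits it as [n^(-e)] plus the quotient of [harm_dim / n^(2 e)] by
   [c_coef / n^e], whence the value of [B]. *)
have H : (n%:R^-1 ^+ e + (harm_dim n (2 * e))%:R / n%:R ^+ (2 * e) *
    (c_coef Q n e / n%:R ^+ e)^-1) @[n --> \oo] --> (0 ^+ e + (2 * e)`!%:R^-1 / - mu : R).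
  apply: cvgD; first exact: cvg_invnX.
  apply: cvgM; first by apply: cvg_harm_dim; lia.
  by apply: cvgV => //; rewrite oppr_eq0 lt_eqF.
have e0 : (0 : R) ^+ e = 0 by rewrite expr0n; case: (e) e_gt0.
rewrite e0 add0r in H; apply: cvg_trans H; apply: near_eq_cvg; near=> n.
have n4 : (4 <= n)%N by near: n; exact: nbhs_infty_ge.
have n2 : (2 <= n)%N by lia.
have [_ [_ Q1]] := gQ n n2.
rewrite /b_coef Q1 mul2n -addnn exprD invf_div exprVn.
have n0 : n%:R ^+ e != 0 :> R by rewrite expf_neq0// pnatr_eq0; lia.
rewrite mulrDl mul1r; congr (_ + _).
by rewrite mulrA invfM mulrA divfK// mulrAC.
Unshelve. all: end_near. Qed.
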